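(* Let $k\ge2$ and let $R_k$ be any $k\times4$ pattern whose first row is $(1,0,1,1)$, whose last row is $(1,1,0,1)$, and each of whose remaining rows is of the form $(\ast,0,0,\ast)$, where each $\ast$ is independently an arbitrary element of $\{0,1\}$. Then $\operatorname{sat}(m_0,n,R_k)=O(1)$ as $n\to\infty$, for every sufficiently large fixed $m_0$.
   Context: All matrices are 0-1 matrices; a pattern is a 0-1 matrix. A matrix $M$ contains $P$ if some submatrix of $M$ (obtained by deleting rows and columns) can be turned into $P$ by changing some number (possibly zero) of its ones to zeroes. The weight is the number of $1$ entries. $M$ is $P$-saturated if $M$ does not contain $P$, but changing any $0$ entry of $M$ to a $1$ yields a matrix containing $P$. $\operatorname{sat}(m,n,P)$ is the minimum weight of an $m\times n$ $P$-saturated matrix. *)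

(* Defs.v *)
From mathcomp Require Import all_boot all_algebra.

Set Implicit Arguments.
Unset Strict Implicit.
Unset Printing Implicit Defensive.

(* 0-1 matrices are matrices over bool, with true for 1 and false for 0. *)

Definition increasing (a b : nat) (f : {ffun 'I_a -> 'I_b}) : bool :=
  [forall i : 'I_a, forall j : 'I_a, (i < j) ==> (f i < f j)].

(* Deleting rows and columns amounts to choosing the surviving rows and
   columns by strictly increasing maps f and g. *)
Definition contains (m n k l : nat)
    (M : 'M[bool]_(m, n)) (P : 'M[bool]_(k, l)) : bool :=
  [exists f : {ffun 'I_k -> 'I_m}, exists g : {ffun 'I_l -> 'I_n},
    [&& increasing f, increasing g &
        [forall i, forall j, P i j ==> mxsub f g M i j]]].

Definition weight (m n : nat) (M : 'M[bool]_(m, n)) : nat :=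
  #|[set p : 'I_m * 'I_n | M p.1 p.2]|.

Definition set_one (m n : nat) (M : 'M[bool]_(m, n)) (i : 'I_m) (j : 'I_n) :
    'M[bool]_(m, n) :=
  \matrix_(i' < m, j' < n) (((i', j') == (i, j)) || M i' j').

Definition saturated (m n k l : nat)
    (P : 'M[bool]_(k, l)) (M : 'M[bool]_(m, n)) : bool :=
  ~~ contains M P &&
  [forall i, forall j, ~~ M i j ==> contains (set_one M i j) P].

(* Since weight M <= m * n always holds, the initial value m * n does not
   affect the minimum as soon as a saturated matrix exists, which is the case
   whenever P has a 1 entry: see sat_attained and sat_le below. *)
Definition sat (m n k l : nat) (P : 'M[bool]_(k, l)) : nat :=
  \big[minn/(m * n)%N]_(M : 'M[bool]_(m, n) | saturated P M) weight M.

Definition row4 (a b c d : bool) : 'rV[bool]_4 :=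
  \row_(j < 4) nth false [:: a; b; c; d] j.

Definition is_R (k : nat) (R : 'M[bool]_(k, 4)) : Prop :=
  [/\ forall i : 'I_k, i = 0 :> nat -> row i R = row4 true false true true,
      forall i : 'I_k, i = k.-1 :> nat -> row i R = row4 true true false true
    & forall i : 'I_k, 0 < i < k.-1 ->
        exists a b : bool, row i R = row4 a false false b].

Lemma weight_max (m n : nat) (M : 'M[bool]_(m, n)) : weight M <= m * n.
Proof. by rewrite /weight (leq_trans (max_card _)) // card_prod !card_ord. Qed.

Lemma sat_le (m n k l : nat) (P : 'M[bool]_(k, l)) (M : 'M[bool]_(m, n)) :
  saturated P M -> sat m n P <= weight M.
Proof.
move=> sM; rewrite /sat; move: (mem_index_enum M).
elim: (index_enum _) => // N r IHr; rewrite inE big_cons.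
case/predU1P=> [<-|/IHr le_r]; first by rewrite sM geq_minl.
by case: ifP => // _; rewrite geq_min le_r orbT.
Qed.

Lemma exists_saturated (m n k l : nat) (P : 'M[bool]_(k, l)) i0 j0 :
  P i0 j0 -> exists M : 'M[bool]_(m, n), saturated P M.
Proof.
move=> P1.
have free0 : ~~ contains (\matrix_(i < m, j < n) false) P.
  apply/existsP=> -[f /existsP[g /and3P[_ _ /forallP/(_ i0)/forallP/(_ j0)]]].
  by rewrite P1 !mxE.
case: (@arg_maxnP _ _ (fun M => ~~ contains M P) (@weight m n) free0) => M freeM maxM.
exists M; rewrite /saturated freeM /=.
apply/forallP=> i; apply/forallP=> j; apply/implyP=> Mij.
apply: contraT => /maxM /=; rewrite leqNgt => /negP[]; apply: proper_card.
apply/properP; split.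
  by apply/subsetP=> -[a b]; rewrite !inE /= mxE => ->; rewrite orbT.
by exists (i, j); rewrite !inE /= ?mxE ?eqxx.
Qed.

Lemma sat_attained (m n k l : nat) (P : 'M[bool]_(k, l)) i0 j0 :
  P i0 j0 ->
  exists2 M : 'M[bool]_(m, n), saturated P M & weight M = sat m n P.
Proof.
move=> P1; have [M0 sM0] := exists_saturated m n P1.
case: (@arg_minnP _ _ (saturated P) (@weight m n) sM0) => M sM minM.
exists M => //; apply/eqP; rewrite eqn_leq sat_le // andbT /sat.
by elim/big_ind: _ => [|x y|//]; [exact: weight_max | rewrite leq_min => -> ->].
Qed.

(* Main.v *)
Require Import Defs.
From mathcomp Require Import all_boot all_algebra.
From mathcomp Require Import zify.

(** The weight stays bounded as soon as some [R]-free matrix has all but a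
    bounded number of its columns blocked, meaning that a new one anywhere in
    such a column completes a copy of [R]: an [R]-free matrix extending it has
    only zeroes there, so any saturated extension is a witness of bounded
    weight ([sat_le_blocked]).

    The matrix used here has a wide empty band of columns, with
    - a full column [l] just left of the band and a full column [r] just right
      of it,
    - [p] columns left of [l], where row [i] has its single one in column
      number [i mod p],
    - [p + 1] columns right of [r], where row [i] has its single one in column
      number [i mod (p + 1)].

    It contains no copy of [R], because it does not even contain the first and
    the last row of [R] together.  By the Chinese remainder theorem two of the
    at most [p * (p + 1)] rows never agree on both sides of the band, so the
    columns where they both have a one are among [x, l, r] or among [l, r, y];
    the outer columns of a copy have to be two of these, which leaves at most
    one column, [l] or [r], for the two inner ones ([residue_mx_free]).

    The band is blocked for the following reason.  The rows
    [i, i + p, i + 2p, ...] have their ones left of [l] in a common column [x],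
    so the columns [x, l, c, r] restricted to [k] of these rows are all ones
    except for column [c] of the band, and the third column of [R] has its only
    one in the first row: a one in row [i] of column [c] completes the copy.
    Likewise the rows [i, i - (p + 1), i - 2(p + 1), ...] and the columns
    [l, c, r, y] give a copy ending in row [i].  If [(k - 1) (2p + 1)] is at
    most the number of rows, one of the two progressions fits, whatever [i] is
    ([residue_mx_blocked]).  Both size conditions hold for a [p] proportional to
    the number of rows. *)

(** * Containment and saturation *)

Section Containment.

Variables m n k l : nat.
Implicit Types (M : 'M[bool]_(m, n)) (P : 'M[bool]_(k, l)).

Lemma increasingP a b (f : {ffun 'I_a -> 'I_b}) :
  reflect (forall i j : 'I_a, i < j -> f i < f j) (increasing f).
Proof.
apply: (iffP forallP) => [H i j ij|H i].
  by move/forallP/(_ j)/implyP: (H i); apply.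
by apply/forallP=> j; apply/implyP; apply: H.
Qed.

(** Placing the copy by functions on [nat] spares the bound proofs inside the
    ordinals when rows and columns are given by arithmetic formulas. *)
Lemma contains_nat M P (f g : nat -> nat) :
    (forall t, t < k -> f t < m) -> (forall s, s < l -> g s < n) ->
    (forall t u, t < u < k -> f t < f u) ->
    (forall s u, s < u < l -> g s < g u) ->
    (forall (t : 'I_k) (s : 'I_l) (i : 'I_m) (j : 'I_n),
       P t s -> i = f t :> nat -> j = g s :> nat -> M i j) ->
  contains M P.
Proof.
move=> fm gn finc ginc PM.
pose F := [ffun t : 'I_k => Ordinal (fm t (ltn_ord t))].
pose G := [ffun s : 'I_l => Ordinal (gn s (ltn_ord s))].
apply/existsP; exists F; apply/existsP; exists G; apply/and3P; split.
- by apply/increasingP=> t u tu; rewrite !ffunE /= finc // tu ltn_ord.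
- by apply/increasingP=> s u su; rewrite !ffunE /= ginc // su ltn_ord.
apply/forallP=> t; apply/forallP=> s; apply/implyP=> Pts.
by rewrite mxE; apply: (PM t s) => //; rewrite ffunE.
Qed.

Lemma contains_mono M M' P :
  (forall i j, M i j -> M' i j) -> contains M P -> contains M' P.
Proof.
move=> sMM' /existsP[f /existsP[g /and3P[finc ginc /forallP PM]]].
apply/existsP; exists f; apply/existsP; exists g; rewrite finc ginc /=.
apply/forallP=> t; apply/forallP=> s; apply/implyP=> Pts.
by move/forallP/(_ s): (PM t); rewrite Pts !mxE => /sMM'.
Qed.

Lemma set_oneE M i j i' j' :
  set_one M i j i' j' = ((i', j') == (i, j)) || M i' j'.
Proof. by rewrite mxE. Qed.

(** A heaviest [P]-free matrix above [M] is saturated. *)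
Lemma saturated_extension M P : ~~ contains M P ->
  exists2 M', saturated P M' & forall i j, M i j -> M' i j.
Proof.
move=> freeM.
pose good M' := ~~ contains M' P && [forall i, forall j, M i j ==> M' i j].
have goodM : good M.
  by rewrite /good freeM; apply/forallP=> i; apply/forallP=> j; apply/implyP.
case: (@arg_maxnP _ _ good (@weight m n) goodM) => M' /andP[freeM' sMM'] maxM'.
have {}sMM' i j : M i j -> M' i j by move/forallP/(_ i)/forallP/(_ j)/implyP: sMM'.
exists M' => //; rewrite /saturated freeM' /=.
apply/forallP=> i; apply/forallP=> j; apply/implyP=> Mij; apply: contraT => free1.
have /maxM' : good (set_one M' i j).
  rewrite /good free1; apply/forallP=> i'; apply/forallP=> j'; apply/implyP=> /sMM'.
  by rewrite set_oneE => ->; rewrite orbT.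
rewrite /= leqNgt => /negP[]; apply: proper_card; apply/properP; split.
  by apply/subsetP=> -[a b]; rewrite !inE /= set_oneE => ->; rewrite orbT.
by exists (i, j); rewrite !inE /= ?set_oneE ?eqxx.
Qed.

Lemma weight_le_columns M (D : {set 'I_n}) :
  (forall i j, j \in D -> ~~ M i j) -> weight M <= m * #|~: D|.
Proof.
move=> MD0; have <- : #|setX [set: 'I_m] (~: D)| = m * #|~: D|.
  by rewrite cardsX cardsT card_ord.
apply: subset_leq_card; apply/subsetP=> -[i j]; rewrite !inE /=.
by apply: contraL; apply: MD0.
Qed.

(** A blocked column stays empty in every [P]-free extension of [M], so the
    bound does not see how many of them there are. *)
Lemma sat_le_blocked M P (D : {set 'I_n}) :
    ~~ contains M P ->
    (forall i j, j \in D -> contains (set_one M i j) P) ->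
  sat m n P <= m * #|~: D|.
Proof.
move=> freeM blocked; have [M' satM' sMM'] := saturated_extension M P freeM.
apply: leq_trans (sat_le satM') _; apply: weight_le_columns => i j /(blocked i) cM1.
case/andP: satM' => freeM' _; apply: contra freeM' => M'ij.
apply: contains_mono cM1 => i' j'; rewrite set_oneE.
by case/predU1P=> [[-> ->]|/sMM'].
Qed.

End Containment.

(** * The shape of the pattern *)

Section Pattern.

Variables (k : nat) (R : 'M[bool]_(k, 4)).
Hypothesis hR : is_R R.

Lemma is_R_first (t : 'I_k) (s : 'I_4) : t = 0 :> nat -> s != 1 :> nat -> R t s.
Proof.
case: hR => H _ _ /H /rowP /(_ s); rewrite !mxE => ->.
by case: s => -[|[|[|[|]]]].
Qed.

Lemma is_R_last (t : 'I_k) (s : 'I_4) : t = k.-1 :> nat -> s != 2 :> nat -> R t s.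
Proof.
case: hR => _ H _ /H /rowP /(_ s); rewrite !mxE => ->.
by case: s => -[|[|[|[|]]]].
Qed.

Lemma is_R_inner (t : 'I_k) (s : 'I_4) : 0 < t < k.-1 -> R t s ->
  (s != 1 :> nat) && (s != 2 :> nat).
Proof.
case: hR => _ _ H /H [a [b /rowP /(_ s)]]; rewrite !mxE => ->.
by case: s => -[|[|[|[|]]]].
Qed.

(** Each inner column of the pattern has a single one, hence its role in a copy
    can be taken by a column that was empty before the new one was added. *)
Lemma is_R_col1 (t : 'I_k) (s : 'I_4) : R t s -> s = 1 :> nat -> t = k.-1 :> nat.
Proof.
move=> Rts s1; have [t0|t_gt0] := posnP t.
  case: hR => /(_ t t0)/rowP/(_ s); rewrite !mxE Rts s1 => H _ _; by [].
have [//|t_neq] := eqVneq (t : nat) k.-1.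
have : 0 < t < k.-1 by have := ltn_ord t; lia.
by move/is_R_inner=> /(_ _ Rts); rewrite s1.
Qed.

Lemma is_R_col2 (t : 'I_k) (s : 'I_4) : R t s -> s = 2 :> nat -> t = 0 :> nat.
Proof.
move=> Rts s2; have [//|t_gt0] := posnP t.
have [tk|t_neq] := eqVneq (t : nat) k.-1.
  case: hR => _ /(_ t tk)/rowP/(_ s); rewrite !mxE Rts s2 => H _; by [].
have : 0 < t < k.-1 by have := ltn_ord t; lia.
by move/is_R_inner=> /(_ _ Rts); rewrite s2.
Qed.

End Pattern.

(** * The construction *)

Definition residue_one (p n i j : nat) : bool :=
  [|| j == i %% p, j == p, j == n - p.+2 | j == n - p.+1 + i %% p.+1].

Definition residue_mx (p m n : nat) : 'M[bool]_(m, n) :=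
  \matrix_(i < m, j < n) residue_one p n i j.

Lemma residues_separate (p i j : nat) : i < j -> j < p * p.+1 ->
  i %% p = j %% p -> i %% p.+1 <> j %% p.+1.
Proof.
move=> ij jp eqp eqp1.
have : p * p.+1 %| j - i.
  rewrite Gauss_dvd ?coprimenS //.
  by rewrite -!eqn_mod_dvd ?(ltnW ij) // eqp eqp1 !eqxx.
by move/dvdn_leq; lia.
Qed.

Section Construction.

Variables (p m n k : nat) (R : 'M[bool]_(k, 4)).
Hypotheses (hR : is_R R) (k_gt1 : 2 <= k) (n_large : p.*2 + 3 <= n).

(** The bound on [m] is what makes the pair of residues determine the row. *)
Lemma residue_mx_free : 0 < p -> m <= p * p.+1 -> ~~ contains (residue_mx p m n) R.
Proof.
move=> p_gt0 m_small.
apply/existsP=> -[f /existsP[g /and3P[/increasingP finc /increasingP ginc]]].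
move=> /forallP Rfg.
have k_gt0 : 0 < k by lia.
have lastk : k.-1 < k by lia.
pose top := Ordinal k_gt0; pose bot := Ordinal lastk.
pose c0 : 'I_4 := Ordinal (isT : 0 < 4); pose c1 : 'I_4 := Ordinal (isT : 1 < 4).
pose c2 : 'I_4 := Ordinal (isT : 2 < 4); pose c3 : 'I_4 := Ordinal (isT : 3 < 4).
have one t s : R t s -> residue_one p n (f t) (g s).
  by move=> Rts; move/forallP/(_ s): (Rfg t); rewrite Rts !mxE.
have T (s : 'I_4) : s != 1 :> nat -> residue_one p n (f top) (g s).
  by move=> s1; apply/one/(is_R_first _ _ hR).
have B (s : 'I_4) : s != 2 :> nat -> residue_one p n (f bot) (g s).
  by move=> s2; apply/one/(is_R_last _ _ hR).
have := (T c0 isT, B c0 isT, T c2 isT, B c1 isT, T c3 isT, B c3 isT).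
have := (ginc c0 c1 isT, ginc c1 c2 isT, ginc c2 c3 isT).
have tb : f top < f bot by apply: finc; rewrite /=; lia.
have := residues_separate p _ _ tb (leq_trans (ltn_ord _) m_small).
rewrite /residue_one.
have := (ltn_pmod (f top) p_gt0, ltn_pmod (f bot) p_gt0).
have := (ltn_pmod (f top) (ltn0Sn p), ltn_pmod (f bot) (ltn0Sn p)).
move: (f top %% p) (f bot %% p) (f top %% p.+1) (f bot %% p.+1).
move: (nat_of_ord (g c0)) (nat_of_ord (g c1)) (nat_of_ord (g c2)) (nat_of_ord (g c3)).
clear -n_large p_gt0.
move=> g0 g1 g2 g3 x x' y y' [yp y'p] [xp x'p] sep [[g01 g12] g23].
case=> [[[[[T0 B0] T2] B1] T3] B3].
(* An outer column of the copy has a one in both rows. *)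
have left_end : (g0 = x /\ x = x') \/ p <= g0.
  by clear -n_large T0 B0 xp x'p; lia.
have right_end : (g3 = n - p.+1 + y /\ y = y') \/ g3 <= n - p.+2.
  by clear -T3 B3 n_large xp x'p yp y'p; lia.
clear T0 B0 T3 B3.
case: left_end => [[g0x xx']|g0p].
  have {}right_end : g3 <= n - p.+2.
    by case: right_end => // -[_ yy']; case: (sep xx' yy').
  by clear -n_large g0x xx' right_end T2 B1 g01 g12 g23 xp x'p; lia.
by clear -n_large g0p right_end T2 B1 g01 g12 g23 xp x'p yp y'p; lia.
Qed.

(** The lower bound on [m] forces [m - i > (k - 1) p] or
    [i >= (k - 1) (p + 1)]: there is room for the progression of step [p] below
    row [i], or for the one of step [p + 1] above it. *)
Lemma residue_mx_blocked (i : 'I_m) (j : 'I_n) :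
    0 < p -> k.-1 * p.*2.+1 <= m -> p < j < n - p.+2 ->
  contains (set_one (residue_mx p m n) i j) R.
Proof.
move=> p_gt0 m_large /andP[pj jr].
have [down|up] := ltnP (i + k.-1 * p) m.
- (* [j] is the third column of a copy with top row [i]. *)
  apply: (@contains_nat _ _ _ _ _ _ (fun t => i + t * p)
            (nth 0 [:: i %% p; p; nat_of_ord j; n - p.+2])).
  + by move=> t tk; apply: leq_ltn_trans down; rewrite leq_add2l leq_mul2r; lia.
  + by have := ltn_pmod i p_gt0; move=> ip [|[|[|[|s]]]] //=; lia.
  + by move=> t u /andP[tu _]; rewrite ltn_add2l ltn_mul2r p_gt0.
  + have := ltn_pmod i p_gt0.
    by move=> ip [|[|[|[|s]]]] [|[|[|[|u]]]] //=; lia.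
  move=> t s i' j' Rts i'E j'E; rewrite set_oneE mxE /residue_one.
  have [s2|s_neq2] := eqVneq (s : nat) 2.
    have t0 := is_R_col2 _ _ hR _ _ Rts s2.
    suff -> : (i', j') = (i, j) by rewrite eqxx.
    by congr pair; apply: val_inj; rewrite /= ?i'E ?j'E ?t0 ?s2 /= ?addn0.
  rewrite j'E i'E [i + _]addnC modnMDl.
  by case: s s_neq2 {Rts j'E} => -[|[|[|[|]]]] //= _ _; rewrite eqxx ?orbT.
(* [j] is the second column of a copy with bottom row [i]. *)
have {}up : k.-1 * p.+1 <= i by move: m_large up; rewrite -addnn; nia.
apply: (@contains_nat _ _ _ _ _ _ (fun t => i - (k.-1 - t) * p.+1)
          (nth 0 [:: p; nat_of_ord j; n - p.+2; n - p.+1 + i %% p.+1])).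
+ by move=> t _; apply: leq_ltn_trans (leq_subr _ _) (ltn_ord i).
+ by have := ltn_pmod i (ltn0Sn p); move=> ip [|[|[|[|s]]]] //=; lia.
+ move=> t u /andP[tu uk]; apply: ltn_sub2l; last by rewrite ltn_mul2r; lia.
  by apply: leq_trans up; nia.
+ by move=> [|[|[|[|s]]]] [|[|[|[|u]]]] //=; lia.
move=> t s i' j' Rts i'E j'E; rewrite set_oneE mxE /residue_one.
have [s1|s_neq1] := eqVneq (s : nat) 1.
  have tk := is_R_col1 _ _ hR _ _ Rts s1.
  suff -> : (i', j') = (i, j) by rewrite eqxx.
  by congr pair; apply: val_inj; rewrite /= ?i'E ?j'E ?tk ?s1 /= ?subnn ?subn0.
rewrite j'E; have <- : i' = i %[mod p.+1].
  rewrite i'E -[in RHS](@subnK ((k.-1 - t) * p.+1) i) //; last first.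
    by apply: leq_trans up; rewrite leq_mul2r; lia.
  by rewrite addnC modnMDl.
by case: s s_neq1 {Rts j'E} => -[|[|[|[|]]]] //= _ _; rewrite eqxx ?orbT.
Qed.

End Construction.

Theorem proposition9p9 (k : nat) (hk : 2 <= k) (R : 'M[bool]_(k, 4))
    (hR : is_R R) :
  exists m1 : nat, forall m0 : nat, m1 <= m0 ->
    exists C N : nat, forall n : nat, N <= n -> sat m0 n R <= C.
Proof.
pose q := k.-1; have q_gt0 : 0 < q by rewrite /q; lia.
exists (3 * q * (3 * q)) => m m_large.
(* [p = m / 3q] makes [q (2p + 1)] about [2m / 3], and [p (p + 1)] is at least
   [m] because [p >= 3q]. *)
pose p := m %/ (3 * q).
have q3_gt0 : 0 < 3 * q by lia.
have p_ge : 3 * q <= p by rewrite leq_divRL.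
have p_gt0 : 0 < p by lia.
have pm : p * (3 * q) <= m by apply: leq_divM.
have mp : m < p.+1 * (3 * q) by apply: ltn_ceil.
clearbody p.
have m_small : m <= p * p.+1.
  by apply: leq_trans (ltnW mp) _; rewrite mulnC leq_mul2r p_ge orbT.
have fits : q * p.*2.+1 <= m by move: pm p_ge; rewrite -addnn; nia.
exists (m * (p.*2 + 3)), (p.*2 + 3) => n n_large.
pose band := [set j : 'I_n | p < j < n - p.+2].
apply: (@leq_trans (m * #|~: band|)).
  apply: (sat_le_blocked _ _ _ _ (residue_mx p m n)).
    exact: residue_mx_free.
  by move=> i j; rewrite inE; apply: residue_mx_blocked.
rewrite leq_mul2l; apply/orP; right.
(* The columns off the band are the first [p + 1] and the last [p + 2]. *)
pose off := iota 0 p.+1 ++ iota (n - p.+2) p.+2.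
have -> : p.*2 + 3 = size off by rewrite size_cat !size_iota; lia.
rewrite cardE -(size_map val); apply: uniq_leq_size.
  by rewrite (map_inj_uniq val_inj) enum_uniq.
move=> _ /mapP[j + ->]; rewrite mem_enum !inE mem_cat !mem_iota /=.
by have := ltn_ord j; lia.
Qed.
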